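(* Let $\Omega$ be a Polish space. For every norm-bounded closed set $\mathcal{M} \subseteq \mathfrak{M}^+(\Omega)$, the mixing operator $\operatorname{Mix} : \mathfrak{M}^+(\mathcal{M}) \to \mathfrak{M}^+(\Omega)$ given by $$\operatorname{Mix}(\nu)(A) = \int_{\mathcal{M}} \mu(A)\,\nu(d\mu) \qquad \text{for every Borel set } A \subseteq \Omega$$ is continuous, where $\mathfrak{M}^+(\mathcal{M})$ and $\mathfrak{M}^+(\Omega)$ both carry the narrow topology.
   Context: For a topological space $X$ (here $X=\Omega$, or $X = \mathcal{M}$ with the subspace topology), $\mathfrak{M}(X)$ denotes the space of Radon charges, i.e. finite signed Radon measures on the Borel $\sigma$-algebra of $X$, and $\mathfrak{M}^+(X)$ denotes the subset of non-negative measures. The norm on $\mathfrak{M}(X)$ is the total variation norm. The narrow topology on $\mathfrak{M}(X)$ is the weakest topology in which the functionals $\mu \mapsto \int_X f(x)\,\mu(dx)$ are continuous for all bounded continuous $f : X \to \mathbb{R}$; $\mathfrak{M}^+(X)$ and all other subsets of $\mathfrak{M}(X)$ carry the subspace topology. The set $\mathcal{M} \subseteq \mathfrak{M}^+(\Omega)$ is closed with respect to the narrow topology, and is itself equipped with the narrow topology and its Borel $\sigma$-algebra; with this topology $\mathcal{M}$ is a Polish space, so $\mathfrak{M}^+(\mathcal{M})$ is the set of finite non-negative Radon measures on the Borel $\sigma$-algebra of $\mathcal{M}$, and its narrow topology is the weakest topology in which the functionals $\nu \mapsto \int_{\mathcal{M}} f(\mu)\,\nu(d\mu)$ are continuous for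 all bounded continuous $f : \mathcal{M} \to \mathbb{R}$. For every Borel $A \subseteq \Omega$ the map $\mu \mapsto \mu(A)$ on $\mathcal{M}$ is Borel, so the integral defining $\operatorname{Mix}(\nu)(A)$ exists. *)

(* Defs.v *)
From HB Require Import structures.
From mathcomp Require Import all_boot all_order all_algebra.
From mathcomp Require Import all_classical all_reals all_analysis.

Set Implicit Arguments.
Unset Strict Implicit.
Unset Printing Implicit Defensive.

Import Order.TTheory GRing.Theory Num.Theory.
Import numFieldNormedType.Exports.

Local Open Scope classical_set_scope.
Local Open Scope ring_scope.
Local Open Scope ereal_scope.

Definition borel (X : topologicalType) : set (set X) := <<s @open X >>.
Arguments borel {X}.

Definition polish (R : realType) (X : topologicalType) : Prop :=
  (exists D : set X, countable D /\ dense D) /\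
  exists d : X -> X -> R,
    [/\ forall x y, (0 <= d x y)%R,
        forall x y, d x y = 0%R <-> x = y,
        forall x y, d x y = d y x &
        forall x y z, (d x z <= d x y + d y z)%R] /\
    (forall x, nbhs x =
       filter_from [set e : R | (0 < e)%R]
         (fun e => [set y | (d x y < e)%R])) /\
    (forall u : nat -> X,
       (forall e : R, (0 < e)%R -> exists N, forall m n,
          (N <= m)%N -> (N <= n)%N -> (d (u m) (u n) < e)%R) ->
       exists l : X, u @ \oo --> l).

(* A measure is a function on the Borel sigma-algebra. It is encoded as a
   function on all subsets which is 0 outside the Borel sets (radon_out), so
   that two elements are equal iff they agree on Borel sets. In radon_inner, a
   compact set that is not Borel contributes 0 to the supremum. X may be empty,
   which is why this is not built on measurableType, whose types are pointed. *)
Record radon_measure (R : realType) (X : topologicalType) := RadonMeasure {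
  radon_fun :> set X -> \bar R ;
  radon0 : radon_fun set0 = 0 ;
  radon_ge0 : forall A, 0 <= radon_fun A ;
  radon_fin_num : forall A, borel A -> radon_fun A \is a fin_num ;
  radon_sigma_additive : forall F : (set X)^nat,
    (forall n, borel (F n)) -> trivIset setT F ->
    (fun n => \sum_(0 <= i < n) radon_fun (F i)) @ \oo
      --> radon_fun (\bigcup_n F n) ;
  radon_inner : forall A, borel A ->
    radon_fun A = ereal_sup (radon_fun @` [set K | compact K /\ K `<=` A]) ;
  radon_out : forall A, ~ borel A -> radon_fun A = 0 }.

HB.instance Definition _ (R : realType) (X : topologicalType) :=
  gen_eqMixin (radon_measure R X).
HB.instance Definition _ (R : realType) (X : topologicalType) :=
  gen_choiceMixin (radon_measure R X).

Definition pointed_at (X : topologicalType) (x : X) : Type := X.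
HB.instance Definition _ (X : topologicalType) (x : X) :=
  Choice.on (pointed_at x).
HB.instance Definition _ (X : topologicalType) (x : X) :=
  isPointed.Build (pointed_at x) x.

Definition borelType (X : topologicalType) (x : X) :=
  g_sigma_algebraType (@open X : set (set (pointed_at x))).
HB.instance Definition _ (X : topologicalType) (x : X) :=
  Measurable.on (borelType x).

Section measure_at.
Context (R : realType) (X : topologicalType) (mu : radon_measure R X) (x : X).

Definition measure_at : set (borelType x) -> \bar R := mu.

Let measure_at0 : measure_at set0 = 0.
Proof. exact: radon0. Qed.

Let measure_at_ge0 A : 0 <= measure_at A.
Proof. exact: radon_ge0. Qed.

Let measure_at_sigma_additive : semi_sigma_additive measure_at.
Proof. by move=> F mF tF _; exact: radon_sigma_additive. Qed.

HB.instance Definition _ := isMeasure.Build _ _ _ measure_at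
  measure_at0 measure_at_ge0 measure_at_sigma_additive.

Let measure_at_fin : fin_num_fun measure_at.
Proof. by move=> A mA; exact: radon_fin_num. Qed.

HB.instance Definition _ :=
  Measure_isFinite.Build _ _ _ measure_at measure_at_fin.

End measure_at.
Arguments measure_at {R X} mu x _.

(* The chosen point only serves to form a measurableType; the value does not
   depend on it. *)
Definition radon_integral (R : realType) (X : topologicalType)
    (mu : radon_measure R X) (f : X -> \bar R) : \bar R :=
  if pselect (exists x : X, True) is left ex
  then \int[measure_at mu (projT1 (cid ex))]_x f x else 0.

Record bounded_continuous (R : realType) (X : topologicalType) := {
  bc_fun :> X -> R ;
  bc_continuous : continuous bc_fun ;
  bc_bounded : bounded_fun bc_fun }.

Definition integrate (R : realType) (X : topologicalType)
    (f : bounded_continuous R X) (mu : radon_measure R X) : R :=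
  fine (radon_integral mu (EFin \o f)).

(* radon_measure R X carries the narrow topology. *)
HB.instance Definition _ (R : realType) (X : topologicalType) :=
  Topological.copy (radon_measure R X)
    (sup_topology (fun f : bounded_continuous R X =>
       Topological.on (initial_topology (integrate f)))).

Definition tv_norm (R : realType) (X : topologicalType)
    (mu : set X -> \bar R) : \bar R :=
  ereal_sup [set s | exists (n : nat) (A : 'I_n -> set X),
    [/\ forall i, borel (A i), trivIset setT A, \bigcup_i A i = setT &
        s = \sum_(i < n) `| mu (A i) |]].

Definition norm_bounded (R : realType) (X : topologicalType)
    (M : set (radon_measure R X)) : Prop :=
  exists c : R, forall mu, M mu -> tv_norm mu <= c%:E.

(* This determines Mix, since measures that agree on Borel sets are equal.
   [radon_measure R M] is taken over the subspace M (a set coerces to the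
   subtype of its elements, with the induced topology). *)
Definition is_mixing (R : realType) (X : topologicalType)
    (M : set (radon_measure R X))
    (Mix : radon_measure R M -> radon_measure R X) : Prop :=
  forall (nu : radon_measure R M) (A : set X), borel A ->
    Mix nu A = radon_integral nu (fun mu : M => set_val mu A).

(* Main.v *)
From HB Require Import structures.
Require Import Defs.
From mathcomp Require Import all_boot all_order all_algebra.
From mathcomp Require Import all_classical all_reals all_analysis.
From mathcomp Require Import measurable_realfun lra.

(** The mixing operator is the barycentre map, and its continuity is a change
of the order of integration. For a bounded continuous f on Omega, the function
F : mu |-> \int f dmu on M is continuous by definition of the narrow topology,
and bounded because the total masses of the elements of M are bounded. Since
    \int f dMix(nu) = \int_M F(mu) nu(dmu)        (integral_mixture),
the functional nu |-> \int f dMix(nu) is integration against the bounded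
continuous function F, hence narrowly continuous; as the narrow topology on the
target is initial for these functionals, Mix is continuous.

Two points make this meaningful. First, mu |-> mu(A) has to be Borel
on M. For A open it is a pointwise limit of the continuous functions
mu |-> \int g_n dmu, where the bounded continuous g_n increase to the indicator
of A; Dynkin's lemma extends this to all Borel A (measurable_evaluation).
Secondly, Mix(nu) has to be a Radon measure. Countable additivity is monotone
convergence and finiteness comes from the norm bound, while inner regularity by
compact sets is Ulam's theorem (ulam): on a Polish space every finite Borel
measure is inner regular by closed sets, and it is tight because complete and
totally bounded sets are compact.

If Omega or M is empty then no base point is available to form a measurable
type, but every integral vanishes and the same identities hold trivially. *)

Set Implicit Arguments.
Unset Strict Implicit.
Unset Printing Implicit Defensive.

Import Order.TTheory GRing.Theory Num.Theory.
Import numFieldNormedType.Exports.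

Local Open Scope classical_set_scope.
Local Open Scope ring_scope.

(** * Metrics compatible with a topology *)

Definition metrizes (R : realType) (X : topologicalType) (d : X -> X -> R) :=
  [/\ forall x y, 0 <= d x y,
      forall x y, d x y = 0 <-> x = y,
      forall x y, d x y = d y x &
      forall x y z, d x z <= d x y + d y z] /\
  (forall x, nbhs x =
     filter_from [set e : R | 0 < e] (fun e => [set y | d x y < e])).

Definition cauchy_complete (R : realType) (X : topologicalType)
    (d : X -> X -> R) := forall u : nat -> X,
  (forall e : R, 0 < e -> exists N, forall m n,
     (N <= m)%N -> (N <= n)%N -> d (u m) (u n) < e) ->
  exists l : X, u @ \oo --> l.

Lemma polish_metrizes (R : realType) (X : topologicalType) : polish R X ->
  exists2 d : X -> X -> R, metrizes d & cauchy_complete d.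
Proof. by move=> [_ [d [dP [nbhs_d cX]]]]; exists d. Qed.

Lemma ultra_bigcup (X : Type) (F : set_system X) (B : nat -> set X) (k : nat) :
  UltraFilter F -> F (\bigcup_(i < k) B i) -> exists i, F (B i).
Proof.
move=> UF; elim: k => [|k IH].
  by rewrite bigcup_mkord big_ord0 => /filter_not_empty.
rewrite bigcup_mkord big_ord_recr/= -bigcup_mkord => FkB.
have [Fk|FkC] := in_ultra_setVsetC (\bigcup_(i < k) B i) UF; first exact: IH.
exists k; apply: filterS (filterI FkB FkC).
by move=> x [[|//]].
Qed.

Section metric.
Context (R : realType) (X : topologicalType) (d : X -> X -> R).
Context (dX : metrizes d).

Let d_ge0 x y : 0 <= d x y. Proof. by case: dX => -[]. Qed.
Let dxx x : d x x = 0. Proof. by case: dX => -[_ /(_ x x)[_ ->]]. Qed.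
Let dC x y : d x y = d y x. Proof. by case: dX => -[]. Qed.
Let d_triangle x y z : d x z <= d x y + d y z. Proof. by case: dX => -[]. Qed.
Let nbhs_d x : nbhs x =
  filter_from [set e : R | 0 < e] (fun e => [set y | d x y < e]).
Proof. by case: dX. Qed.

Lemma continuous_1lipschitz (f : X -> R) :
  (forall x y, f x <= f y + d x y) -> continuous f.
Proof.
move=> lf x; apply/cvgrPdist_lt => e e0.
rewrite near_simpl /prop_near1 nbhs_d; exists e => //= y /= xy.
rewrite ltr_distl; have := lf x y; have := lf y x; rewrite (dC y x).
by move=> *; apply/andP; split; lra.
Qed.

Lemma continuous_dist x : continuous (d x).
Proof.
by apply: continuous_1lipschitz => y z; rewrite (dC y z); exact: d_triangle.
Qed.

Lemma closed_closed_ball x (r : R) : closed [set y | d x y <= r].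
Proof.
apply: (@preimage_closed _ _ (d x) [set s | s <= r]).
  by move=> y _; exact: continuous_dist.
exact: closed_le.
Qed.

(** The distance to the complement of [U], truncated at 1. The truncation keeps
the infimum meaningful when [U] is the whole space. *)
Definition codist (U : set X) (x : X) : R :=
  inf ([set 1] `|` [set d x y | y in ~` U]).

Let codist_set_lb U x : lbound ([set 1] `|` [set d x y | y in ~` U]) 0.
Proof. by move=> _ [->|[y _ <-]]. Qed.

Let codist_set_neq0 U x : [set 1] `|` [set d x y | y in ~` U] !=set0.
Proof. by exists 1; left. Qed.

Lemma codist_ge0 U x : 0 <= codist U x.
Proof. exact: lb_le_inf. Qed.

Lemma codist_le1 U x : codist U x <= 1.
Proof. by apply: ge_inf; [exists 0|left]. Qed.

Lemma codist_le_dist U x y : ~ U y -> codist U x <= d x y.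
Proof. by move=> Uy; apply: ge_inf; [exists 0|right; exists y]. Qed.

Lemma codist_out U x : ~ U x -> codist U x = 0.
Proof.
move=> Ux; apply/eqP; rewrite eq_le codist_ge0 andbT.
by rewrite (le_trans (codist_le_dist x Ux))// dxx.
Qed.

Lemma codist_gt0 U x : open U -> U x -> 0 < codist U x.
Proof.
rewrite openE => oU /oU; rewrite /interior nbhs_d => -[e /= e0 xeU].
apply: (@lt_le_trans _ _ (Order.min 1 e)); first by rewrite lt_min ltr01.
apply: lb_le_inf => // _ [->|[y Uy <-]]; first by rewrite ge_min lexx.
rewrite ge_min orbC leNgt; apply/orP; left; apply/negP => xy.
by apply: Uy; exact: xeU.
Qed.

Lemma continuous_codist U : continuous (codist U).
Proof.
apply: continuous_1lipschitz => x y; rewrite -lerBlDr.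
apply: lb_le_inf => // _ [->|[z Uz <-]].
  by rewrite lerBlDr (le_trans (codist_le1 U x))// lerDl.
by rewrite lerBlDr (le_trans (codist_le_dist x Uz))// addrC.
Qed.

(** In a complete space, a closed set with finite covers by balls of radius
1/(n+1) for all n is compact: an ultrafilter on it contains a ball of each of
these radii, and points chosen in the finite intersections of these balls form
a Cauchy sequence whose limit is the limit of the ultrafilter. *)
Lemma compact_complete (K : set X) (u : nat -> X) (s : nat -> nat) :
  cauchy_complete d -> closed K ->
  (forall n, K `<=` \bigcup_(i < s n) [set y | d (u i) y <= n.+1%:R^-1]) ->
  compact K.
Proof.
move=> cX cK Ku; rewrite compact_ultra => F UF FK.
have /choice[c Fc] n : exists c, F [set y | d c y <= n.+1%:R^-1].
  have [|i Fi] := @ultra_bigcup _ F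
    (fun i => [set y | d (u i) y <= n.+1%:R^-1]) (s n) UF.
    exact: filterS (Ku n) FK.
  by exists (u i).
pose H n := \bigcap_(i < n.+1) [set y | d (c i) y <= i.+1%:R^-1].
have FH n : F (H n).
  elim: n => [|n IH].
    by apply: filterS (Fc 0) => y c0y [|].
  apply: filterS (filterI IH (Fc n.+1)) => y [Hy cy] i /=.
  by rewrite ltnS leq_eqVlt => /predU1P[->//|]; exact: Hy.
have /choice[v Hv] n : exists y, H n y.
  by have [y] := @filter_ex _ F _ _ (FH n); exists y.
have small (e : R) : 0 < e -> exists N, N.+1%:R^-1 + N.+1%:R^-1 < e.
  move=> e0; have /ltr_add_invr[N] : 0 < e / 2 by rewrite divr_gt0.
  by rewrite add0r => Ne; exists N; rewrite (splitr e) ltrD.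
have near_c N y z : d (c N) y <= N.+1%:R^-1 -> d (c N) z <= N.+1%:R^-1 ->
    d y z <= N.+1%:R^-1 + N.+1%:R^-1.
  by move=> cy cz; rewrite (le_trans (d_triangle _ (c N) _))// dC lerD.
have [|l vl] := cX v.
  move=> e /small[N Ne]; exists N => m n Nm Nn.
  by rewrite (le_lt_trans (near_c N _ _ (Hv m N Nm) (Hv n N Nn))).
have Fl : F --> l.
  move=> A; rewrite nbhs_d => -[e /= e0 eA].
  have /small[N Ne] : 0 < e / 2 by rewrite divr_gt0.
  have /vl[M _ vM] : nbhs l [set y | d l y < e / 2].
    by rewrite nbhs_d; exists (e / 2) => //=; rewrite divr_gt0.
  apply: filterS (Fc N) => y cy; apply: eA => /=.
  have lv := vM (maxn M N) (leq_maxl _ _).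
  have vy : d (v (maxn M N)) y <= N.+1%:R^-1 + N.+1%:R^-1.
    apply: (near_c N) => //; apply: (Hv _ N).
    by rewrite /= ltnS leq_maxr.
  have := d_triangle l (v (maxn M N)) y.
  by move: lv vy Ne => /=; move: (N.+1%:R^-1) => p *; lra.
exists l; split=> //.
apply: cK => A /Fl FA.
exact: (@filter_ex _ F _ _ (filterI FK FA)).
Qed.

Lemma dense_bigcup_balls (D : set X) (u : nat -> X) (r : R) :
  dense D -> D `<=` range u -> 0 < r ->
  \bigcup_k \bigcup_(i < k) [set y | d (u i) y <= r] = setT.
Proof.
move=> denseD Du r0; rewrite -subTset => x _.
have [y [/= xy Dy]] : [set y | d x y < r] `&` D !=set0.
  apply: denseD; first by exists x; rewrite /= dxx.
  apply: (open_comp (f := d x) (D := [set s | s < r])).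
    by move=> z _; exact: continuous_dist.
  exact: open_lt.
have [i _ iy] := Du y Dy.
by exists i.+1 => //; exists i => //=; rewrite iy dC ltW.
Qed.

End metric.
Arguments codist {R X} d U x.

(** * Regularity of finite Borel measures *)

Section approximation.
Context {dT : measure_display} {T : measurableType dT} {R : realType}.
Context (mu : {finite_measure set T -> \bar R}).

(** Errors that sum to at most [e] survive countable intersections. Applied to
complements, this also treats countable unions. *)
Lemma cap_approx (A C : nat -> set T) (e : R) :
  (forall n, measurable (A n)) -> (forall n, measurable (C n)) -> 0 <= e ->
  (forall n, (mu (A n `\` C n) <= (e / (2 ^ n.+1)%:R)%:E)%E) ->
  (mu (\bigcap_n A n `\` \bigcap_n C n) <= e%:E)%E.
Proof.
move=> mA mC e0 AC.
apply: (@le_trans _ _ (\sum_(0 <= n <oo) mu (A n `\` C n))%E); last first.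
  apply: le_trans (epsilon_trick0 xpredT e0).
  by apply: lee_nneseries => // n _; exact: AC.
apply: measure_sigma_subadditive.
- by move=> n; exact: measurableD.
- by apply: measurableD; exact: bigcap_measurable.
- move=> x [Ax] /existsNP[n /not_implyP[_ Cx]].
  by exists n => //; split => //; exact: Ax.
Qed.

(** Continuity from above of the finite measure [mu], along the sets still
missed by [F n]. *)
Lemma cup_approx (F : nat -> set T) (e : R) :
  (forall n, measurable (F n)) -> nondecreasing_seq F -> 0 < e ->
  exists N, (mu (\bigcup_n F n `\` F N) <= e%:E)%E.
Proof.
move=> mF ndF e0; set U := \bigcup_n F n.
have mU : measurable U by exact: bigcup_measurable.
have capE : \bigcap_n (U `\` F n) = set0.
  rewrite -subset0 => x UF; have [[n _ Fx] _] := UF 0 I.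
  by have [] := UF n I.
have : mu (U `\` F n) @[n --> \oo] --> 0%E.
  rewrite -(measure0 mu) -capE; apply: nonincreasing_cvg_mu.
  - by rewrite -ge0_fin_numE//; apply: fin_num_measure; exact: measurableD.
  - by move=> n; exact: measurableD.
  - by apply: bigcap_measurable => // n _; exact: measurableD.
  - move=> m n mn; apply/subsetPset; apply: setDS.
    by move: (ndF _ _ mn) => /subsetPset.
move=> /fine_cvgP[finU /cvgr0Pnorm_lt /(_ _ e0) small].
have [N [finN smallN]] : exists N, mu (U `\` F N) \is a fin_num /\
    `|fine (mu (U `\` F N))| < e.
  by have [N _ /(_ _ (leqnn N))] := filterI finU small; exists N.
exists N; rewrite -(fineK finN) lee_fin (le_trans (ler_norm _))//.
exact/ltW.
Qed.

End approximation.

Section borel_measure.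
Context {R : realType} {X : topologicalType} (x0 : X).
Local Notation T := (borelType x0).

Lemma borel_open (U : set T) : open (U : set X) -> measurable U.
Proof. exact: sub_gen_smallest. Qed.

Lemma borel_closed (C : set T) : closed (C : set X) -> measurable C.
Proof.
move=> cC; rewrite -(setCK C); apply: measurableC; apply: borel_open.
exact: (closed_openC cC).
Qed.

Lemma continuous_borel (f : X -> R) :
  continuous f -> measurable_fun [set: T] (f : T -> R).
Proof.
move=> /continuousP cf; apply: (measurability _ (RGenOpens.measurableE R)).
move=> _ [_ [a [b ->] <-]]; rewrite setTI; apply: borel_open.
exact/cf/interval_open.
Qed.

End borel_measure.

Section regularity.
Context (R : realType) (X : topologicalType) (d : X -> X -> R).
Context (dX : metrizes d).
Context (x0 : X).
Local Notation T := (borelType x0).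
Context (mu : {finite_measure set T -> \bar R}).

Definition inner_closed (A : set T) := forall e : R, 0 < e ->
  exists C : set T, [/\ closed (C : set X), C `<=` A &
    (mu (A `\` C) <= e%:E)%E].

(** An open set is the increasing union of the closed sets of points at
distance at least 1/(n+1) from its complement. *)
Lemma inner_closed_open (U : set T) : open (U : set X) -> inner_closed U.
Proof.
move=> oU e e0.
pose F n : set T := [set x | n.+1%:R^-1 <= codist d U x].
have cF n : closed (F n : set X).
  apply: (@preimage_closed _ _ (codist d U) [set s | n.+1%:R^-1 <= s]).
    by move=> y _; exact: continuous_codist.
  exact: closed_ge.
have FU n : F n `<=` U.
  move=> x; apply: contraPP => Ux; rewrite /F/= (codist_out dX Ux).
  by apply/negP; rewrite -ltNge invr_gt0.
have UE : U = \bigcup_n F n.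
  apply/seteqP; split=> [x Ux|x [n _ /FU]//].
  have /ltr_add_invr[n] := codist_gt0 dX oU Ux.
  by rewrite add0r => /ltW ?; exists n.
have [|m n mn|N FN] := @cup_approx _ _ _ mu F e _ _ e0.
- by move=> n; exact: borel_closed.
- apply/subsetPset => x; apply: le_trans.
  by rewrite lef_pV2 ?posrE// ler_nat.
by exists (F N); split => //; rewrite {1}UE.
Qed.

Lemma inner_closed_bigcap (A : nat -> set T) : (forall n, measurable (A n)) ->
  (forall n, inner_closed (A n)) -> inner_closed (\bigcap_n A n).
Proof.
move=> mA icA e e0.
have /choice[C CA] n := icA n (e / (2 ^ n.+1)%:R) ltac:(by rewrite divr_gt0).
exists (\bigcap_n C n); split.
- by apply: closed_bigI => n _; have [] := CA n.
- by move=> x Cx n _; have [_ CnA _] := CA n; exact/CnA/Cx.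
- apply: cap_approx => // [n||n]; last by have [] := CA n.
  + by apply: borel_closed; have [] := CA n.
  + exact: ltW.
Qed.

Lemma inner_closed_bigcup (A : nat -> set T) : (forall n, measurable (A n)) ->
  (forall n, inner_closed (A n)) -> inner_closed (\bigcup_n A n).
Proof.
move=> mA icA e e0; have e20 : 0 < e / 2 by rewrite divr_gt0.
have /choice[C CA] n := icA n (e / 2 / (2 ^ n.+1)%:R)
  ltac:(by rewrite divr_gt0).
have mC n : measurable (C n) by apply: borel_closed; have [] := CA n.
(* The union of all the C n need not be closed: it is truncated. *)
pose F n : set T := \bigcup_(i < n) C i.
have cF n : closed (F n : set X).
  by apply: closed_bigcup => // i _; have [] := CA i.
have FE : \bigcup_n F n = \bigcup_n C n.
  apply/seteqP; split => [x [n _ [i _ Cx]]|x [n _ Cx]]; first by exists i.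
  by exists n.+1 => //; exists n => /=.
have [|m n mn|N FN] := @cup_approx _ _ _ mu F (e / 2) _ _ e20.
- by move=> n; exact: borel_closed.
- apply/subsetPset => x [i im Cx]; exists i => //=.
  exact: leq_trans mn.
exists (F N); split => //.
  by move=> x [i _ Cx]; exists i => //; have [_ CiA _] := CA i; exact: CiA.
rewrite (splitr e) EFinD.
have mUC : measurable (\bigcup_n C n) by exact: bigcup_measurable.
have mUA : measurable (\bigcup_n A n) by exact: bigcup_measurable.
have mFN : measurable (F N) by exact: borel_closed.
apply: (@le_trans _ _ (mu (\bigcup_n A n `\` \bigcup_n C n) +
                       mu (\bigcup_n C n `\` F N)))%E.
  apply: (le_trans _ (measureU2 _ _ _)); last 2 first.
  - exact: measurableD.
  - exact: measurableD.
  apply: le_measure; rewrite ?inE.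
  - exact: measurableD.
  - by apply: measurableU; exact: measurableD.
  move=> x [Ax nFx]; have [Cx|nCx] := pselect ((\bigcup_n C n) x).
    by right.
  by left.
apply: leeD; last by rewrite -FE.
have -> : \bigcup_n A n `\` \bigcup_n C n =
    \bigcap_n (~` C n) `\` \bigcap_n (~` A n).
  rewrite -!setC_bigcup; apply/seteqP; split => x /=.
    by move=> [Ax Cx]; split => // -[].
  by move=> [Cx /contrapT Ax].
apply: cap_approx => [n|n||n].
- exact: measurableC.
- exact: measurableC.
- exact: ltW.
- rewrite [X in mu X](_ : _ = A n `\` C n); first by have [] := CA n.
  by rewrite setDE setCK setIC.
Qed.

(** Inner regularity by closed sets alone does not pass to complements, so the
induction over the sigma-algebra carries it for a set and its complement. *)
Lemma inner_closed_borel (A : set T) : measurable A -> inner_closed A.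
Proof.
suff : forall A : set T, measurable A ->
    [/\ measurable A, inner_closed A & inner_closed (~` A)].
  by move=> + mA => /(_ A mA)[].
clear A; apply: smallest_sub; last first.
  move=> U oU; split; first exact: borel_open.
    exact: inner_closed_open.
  move=> e e0; exists (~` U); rewrite setDv measure0 lee_fin ltW//; split => //.
  exact: open_closedC.
have ic0 : inner_closed set0.
  move=> e e0; exists set0; rewrite setDv measure0 lee_fin ltW//; split => //.
  exact: closed0.
split.
- split => //; rewrite setC0; apply: inner_closed_open; exact: openT.
- move=> A [mA icA icAC]; rewrite setTD setCK; split => //.
  exact: measurableC.
- move=> A AP; split.
  + by apply: bigcup_measurable => n _; have [] := AP n.
  + by apply: inner_closed_bigcup => n; have [] := AP n.
  + rewrite setC_bigcup; apply: inner_closed_bigcap => n; have [mA _ ic]:= AP n.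
      exact: measurableC.
    exact: ic.
Qed.

Context (D : set X) (countD : countable D) (denseD : dense D).

(** For each n, finitely many balls of radius 1/(n+1) centred in a dense
sequence cover all but an e/2^(n+1) portion of the mass; the intersection over
n of these finite unions is closed and totally bounded. *)
Lemma tight : cauchy_complete d -> forall e : R, 0 < e ->
  exists K : set T, [/\ compact (K : set X), closed (K : set X) &
    (mu (~` K) <= e%:E)%E].
Proof.
move=> cX e e0.
have [u Du] : exists u : nat -> X, D `<=` range u.
  move/pfcard_geP : countD => [->|[f]]; first by exists (fun=> x0).
  by exists f => y /(@surj _ _ _ _ f).
pose F (n k : nat) : set T :=
  \bigcup_(i < k) [set y | d (u i) y <= n.+1%:R^-1].
have cF n k : closed (F n k : set X).
  by apply: closed_bigcup => // i _; exact: (closed_closed_ball dX).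
have FT n : \bigcup_k F n k = setT.
  by apply: (dense_bigcup_balls dX denseD Du); rewrite invr_gt0.
have /choice[s Fs] n :
    exists k, (mu (setT `\` F n k) <= (e / (2 ^ n.+1)%:R)%:E)%E.
  rewrite -(FT n); apply: cup_approx; last by rewrite divr_gt0.
    by move=> k; exact: borel_closed.
  move=> k l kl; apply/subsetPset => x [i ik Fx]; exists i => //=.
  exact: leq_trans kl.
have cK : closed (\bigcap_n F n (s n) : set X) by apply: closed_bigI.
exists (\bigcap_n F n (s n)); split => //.
- by apply: (@compact_complete _ _ _ dX _ u s) => // n x /(_ n I).
- have -> : ~` (\bigcap_n F n (s n)) =
      \bigcap_(n : nat) (setT : set T) `\` \bigcap_n F n (s n).
    apply/seteqP; split => x; first by move=> FC; split.
    by case.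
  apply: cap_approx => //.
    by move=> n; exact: borel_closed.
  exact: ltW.
Qed.

(** Ulam's theorem: intersect a closed set approximating [A] with a compact set
carrying almost all the mass. *)
Lemma ulam (A : set T) : cauchy_complete d -> measurable A ->
  forall e : R, 0 < e -> exists K : set T,
    [/\ compact (K : set X), measurable K, K `<=` A &
        (mu A <= mu K + e%:E)%E].
Proof.
move=> cX mA e e0; have e20 : 0 < e / 2 by rewrite divr_gt0.
have [C [cC CA AC]] := inner_closed_borel mA e20.
have [K [compK cK muK]] := tight cX e20.
have mC : measurable C by exact: borel_closed.
have mK : measurable K by exact: borel_closed.
exists (C `&` K); split.
- by apply: (subclosed_compact _ compK); [exact: closedI|exact: subIsetr].
- exact: measurableI.
- by move=> x [/CA].
- rewrite (splitr e) EFinD addeA.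
  apply: (@le_trans _ _ (mu ((C `&` K) `|` (A `\` C) `|` ~` K))).
    apply: le_measure; rewrite ?inE//.
      apply: measurableU; last exact: measurableC.
      by apply: measurableU; [exact: measurableI|exact: measurableD].
    move=> x Ax; have [Cx|] := pselect (C x); last by left; right.
    by have [Kx|] := pselect (K x); [left; left|right].
  apply: (le_trans (measureU2 _ _ _)).
  - by apply: measurableU; [exact: measurableI|exact: measurableD].
  - exact: measurableC.
  apply: leeD => //; apply: (le_trans (measureU2 _ _ _)).
  - exact: measurableI.
  - exact: measurableD.
  exact: leeD.
Qed.
End regularity.

(** Inner regularity is the only Radon axiom that a finite Borel measure could
fail, and [ulam] provides it. *)
Lemma radon_of_borel (R : realType) (X : topologicalType) (x0 : X)
  (m : {finite_measure set (borelType x0) -> \bar R}) : polish R X ->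
  exists mu : radon_measure R X, forall A, borel A -> mu A = m A.
Proof.
move=> polX; have [[D [countD denseD]] _] := polX.
have [d dX cX] := polish_metrizes polX.
pose mu (A : set X) : \bar R := if pselect (borel A) then m A else 0%E.
have muE A : borel A -> mu A = m A by rewrite /mu; case: pselect.
unshelve eexists (@RadonMeasure R X mu _ _ _ _ _ _) => //=.
- by rewrite muE ?measure0//; exact: (@measurable0 _ (borelType x0)).
- by move=> A; rewrite /mu; case: pselect => // bA; exact: measure_ge0.
- by move=> A bA; rewrite muE//; exact: fin_num_measure.
- move=> F bF tF; have bUF : borel (\bigcup_n F n).
    exact: (@bigcupT_measurable _ (borelType x0)).
  rewrite muE//.
  under eq_fun do under eq_bigr do rewrite muE//.
  exact: measure_semi_sigma_additive.
- move=> A bA; rewrite muE//; apply/eqP; rewrite eq_le; apply/andP; split.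
    apply/lee_addgt0Pr => e e0.
    have [K [compK mK KA mAK]] := ulam dX m countD denseD cX bA e0.
    rewrite (le_trans mAK)// leeD2r//; apply: ereal_sup_ubound.
    by exists K => //; rewrite muE.
  apply: ge_ereal_sup => _ [K [_ KA] <-]; rewrite /mu.
  case: pselect => bK; last exact: measure_ge0.
  by apply: le_measure => //; rewrite inE; [exact: bK|exact: bA].
- by move=> A; rewrite /mu; case: pselect.
Qed.

(** * Mixtures of measures *)

Section mixture.
Context {d1 d2} {Y : measurableType d1} {Z : measurableType d2} {R : realType}.
Context (N : {measure set Y -> \bar R}) (k : Y -> {measure set Z -> \bar R}).
Context (mk : forall A, measurable A -> measurable_fun [set: Y] (k ^~ A)).
Local Open Scope ereal_scope.

Section integral.
Context (P : {measure set Z -> \bar R}).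
Context (PE : forall A, measurable A -> P A = \int[N]_y k y A).
Import HBNNSimple.

Lemma sintegral_mixture (h : {nnsfun Z >-> R}) :
  sintegral P h = \int[N]_y sintegral (k y) h.
Proof.
under eq_integral do rewrite sintegralE.
rewrite ge0_integral_fsum//; last 2 first.
  by move=> r; apply: measurable_funeM; exact: mk.
  by move=> n x _; exact: nnsfun_mulemu_ge0.
rewrite sintegralE; apply: eq_fsbigr => r _.
have [r0|r0] := leP 0%R r.
  by rewrite ge0_integralZl_EFin//; [rewrite PE|exact: mk].
(* A nonnegative simple function does not take the value r < 0. *)
rewrite preimage_nnfun0// measure0 mule0.
by rewrite integral0_eq// => y _; rewrite measure0 mule0.
Qed.

Lemma ge0_integral_mixture (f : Z -> \bar R) :
  measurable_fun [set: Z] f -> (forall z, 0 <= f z) ->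
  \int[P]_z f z = \int[N]_y \int[k y]_z f z.
Proof.
move=> mf f0.
pose g := nnsfun_approx measurableT mf.
pose gE := fun n => EFin \o g n.
have mgE n : measurable_fun [set: Z] (gE n) by exact/measurable_EFinP.
have gE_ge0 n x : 0 <= gE n x by rewrite lee_fin.
have nd_gE x : {homo gE ^~ x : n m / (n <= m)%O >-> n <= m}.
  by move=> *; exact/lefP/nd_nnsfun_approx.
have intE (m : {measure set Z -> \bar R}) :
    \int[m]_z f z = limn (fun n => \int[m]_z gE n z).
  rewrite -monotone_convergence//; apply: eq_integral => t _.
  by apply/esym/cvg_lim => //; exact: cvg_nnsfun_approx.
rewrite intE.
under [RHS]eq_integral do rewrite intE.
rewrite monotone_convergence//; last 3 first.
- move=> n; apply: measurable_fun_integral_kernel => //.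
- by move=> n y _; exact: integral_ge0.
- by move=> y _ m n mn; apply: ge0_le_integral => // t _; exact: nd_gE.
apply: congr_lim; apply/funext => n.
rewrite integralT_nnsfun sintegral_mixture; apply: eq_integral => y _.
by rewrite integralT_nnsfun.
Qed.

(** The positive and negative parts are integrated separately; integrability
with respect to [P] is what makes their two mixed integrals finite. *)
Lemma integral_mixture (f : Z -> R) :
  (forall y, (k y).-integrable [set: Z] (EFin \o f)) ->
  P.-integrable [set: Z] (EFin \o f) ->
  \int[P]_z (f z)%:E = \int[N]_y \int[k y]_z (f z)%:E.
Proof.
move=> kf Pf; have mf : measurable_fun [set: Z] (EFin \o f).
  by case/integrableP : Pf.
have mfp := measurable_funepos mf; have mfn := measurable_funeneg mf.
rewrite [LHS]integralE !ge0_integral_mixture//.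
have int_ge0 g : measurable_fun [set: Z] g -> (forall z, 0 <= g z) ->
    P.-integrable [set: Z] g ->
    N.-integrable [set: Y] (fun y => \int[k y]_z g z).
  move=> mg g0 /integrableP[_ Pg]; apply/integrableP; split.
    exact: measurable_fun_integral_kernel.
  under eq_integral do rewrite gee0_abs ?integral_ge0//.
  rewrite -ge0_integral_mixture//; apply: le_lt_trans Pg.
  by under [leRHS]eq_integral do rewrite gee0_abs//.
rewrite -integralB//.
- by apply: eq_integral => y _; rewrite [RHS]integralE.
- by apply: int_ge0 => //; exact: integrable_funepos.
- by apply: int_ge0 => //; exact: integrable_funeneg.
Qed.

End integral.

Let mix (A : set Z) : \bar R := \int[N]_y k y A.

Let mix0 : mix set0 = 0.
Proof. by rewrite /mix integral0_eq. Qed.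

Let mix_ge0 A : 0 <= mix A.
Proof. exact: integral_ge0. Qed.

Let mix_sigma_additive : semi_sigma_additive mix.
Proof.
move=> F mF tF _; rewrite [X in _ --> X](_ : _ =
    \int[N]_y (\sum_(0 <= i <oo) k y (F i))); last first.
  apply: eq_integral => y _.
  by apply/esym/cvg_lim => //; exact: measure_sigma_additive.
rewrite [X in X @ _](_ : _ =
    (fun n => \int[N]_y (\sum_(0 <= i < n) k y (F i)))); last first.
  by apply/funext => n; rewrite -ge0_integral_sum// => i; exact: mk.
apply: cvg_monotone_convergence => //.
- by move=> n; apply: emeasurable_sum => i; exact: mk.
- by move=> n y _; rewrite sume_ge0.
- by move=> y _ m n mn; exact: ereal_nondecreasing_series.
Qed.

HB.instance Definition _ := isMeasure.Build _ _ _ mix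
  mix0 mix_ge0 mix_sigma_additive.

Lemma mixture_exists : fin_num_fun (fun A => \int[N]_y k y A) ->
  exists P : {finite_measure set Z -> \bar R},
    forall A, P A = \int[N]_y k y A.
Proof.
move=> fin_mix.
pose mixF := Measure_isFinite.Build _ _ _ mix fin_mix.
pose P : {finite_measure set Z -> \bar R} := HB.pack mix mixF.
by exists P.
Qed.

End mixture.

(** * Integrals against Radon measures and the narrow topology *)

(** One base point computes all the integrals on a nonempty space, because the
point picked in [radon_integral] depends only on the space. *)
Lemma radon_integral_point (R : realType) (X : topologicalType) :
  (X -> False) \/
  exists x0 : X, forall (mu : radon_measure R X) f,
    radon_integral mu f = (\int[measure_at mu x0]_x f x)%E.
Proof.
have [ex|nex] := pselect (exists x : X, True); last first.
  by left => x; apply: nex; exists x.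
right; exists (projT1 (cid ex)) => mu f; rewrite /radon_integral.
by case: pselect => // ex'; rewrite (Prop_irrelevance ex ex').
Qed.

Section bounded_continuous_integral.
Context (R : realType) (X : topologicalType) (x0 : X).

Lemma bc_bound (f : bounded_continuous R X) :
  exists2 C : R, 0 <= C & forall x, `|f x| <= C.
Proof.
have [M [_ /(_ (M + 1))]] := bc_bounded f.
rewrite ltrDl ltr01 => /(_ isT) fM.
exists (M + 1); last by move=> x; exact: fM.
by apply: le_trans (fM x0 I).
Qed.

Lemma bc_integrable (f : bounded_continuous R X) (mu : radon_measure R X) :
  (measure_at mu x0).-integrable [set: borelType x0] (EFin \o f).
Proof.
apply: measurable_bounded_integrable => //.
- by rewrite -ge0_fin_numE//; exact: fin_num_measure.
- exact: continuous_borel (bc_continuous (b := f)).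
- exact: bc_bounded.
Qed.

Lemma bc_integral_le (f : bounded_continuous R X) (mu : radon_measure R X) C :
  (forall x, `|f x| <= C) ->
  `|fine (\int[measure_at mu x0]_x (f x)%:E)| <= C * fine (mu setT).
Proof.
move=> fC.
have finf : (\int[measure_at mu x0]_x (f x)%:E)%E \is a fin_num.
  exact: integrable_fin_num (bc_integrable f mu).
have finT : mu setT \is a fin_num.
  exact: (fin_num_measure (measure_at mu x0) _ measurableT).
rewrite -lee_fin EFinM -abse_EFin !fineK//.
apply: (le_trans (le_abse_integral _ _ _)) => //.
  by case/integrableP : (bc_integrable f mu).
apply: (le_trans (integral_le_bound (C%:E) _ _ _ _)) => //.
- by case/integrableP : (bc_integrable f mu).
- exact: le_trans (fC x0).
- by apply: aeW => x _; rewrite lee_fin.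
Qed.

End bounded_continuous_integral.

Lemma continuous_integrate (R : realType) (X : topologicalType)
  (f : bounded_continuous R X) : continuous (integrate f).
Proof.
move=> mu A fA.
have /cvg_sup/(_ f) : nbhs mu --> mu by exact: cvg_id.
by apply; exact: (@initial_continuous _ _ (integrate f) mu).
Qed.

Lemma continuous_narrow (R : realType) (X Y : topologicalType)
  (g : Y -> radon_measure R X) :
  (forall f : bounded_continuous R X, continuous (integrate f \o g)) ->
  continuous g.
Proof.
move=> cg y; apply/cvg_sup => f.
by apply: (@continuous_comp_initial _ _ _ (integrate f) g).
Qed.

Section evaluation.
Context (R : realType) (X Y : topologicalType) (d : X -> X -> R).
Context (dX : metrizes d) (x0 : X) (y0 : Y).
Context (x0E : forall (mu : radon_measure R X) f,
  radon_integral mu f = (\int[measure_at mu x0]_x f x)%E).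
Context (k : Y -> radon_measure R X) (ck : continuous k).

(** With [c] the truncated distance to the complement of [U], the functions
1 - (1 - c)^n increase to the indicator function of [U]. *)
Lemma soft_indic_continuous (U : set X) n :
  continuous (fun x => 1 - (1 - codist d U x) ^+ n).
Proof.
move=> x; apply: cvgB; first exact: cvg_cst.
apply: (@continuous_comp _ _ _ (fun y => 1 - codist d U y)
  (@GRing.exp R ^~ n)); last exact: exprn_continuous.
by apply: cvgB; [exact: cvg_cst|exact: (continuous_codist dX)].
Qed.

Lemma soft_indic_itv (U : set X) n x :
  0 <= 1 - (1 - codist d U x) ^+ n <= 1.
Proof.
have c0 := codist_ge0 dX U x; have c1 := codist_le1 dX U x.
rewrite subr_ge0 exprn_ile1 ?subr_ge0 ?lerBlDr ?lerDl//=.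
by rewrite exprn_ge0// subr_ge0.
Qed.

Lemma soft_indic_bounded (U : set X) n :
  bounded_fun (fun x => 1 - (1 - codist d U x) ^+ n).
Proof.
exists 1; split => // M M1 x _ /=.
have /andP[c0 c1] := soft_indic_itv U n x.
by rewrite ger0_norm// (le_trans c1)// ltW.
Qed.

Definition soft_indic (U : set X) n := Build_bounded_continuous
  (@soft_indic_continuous U n) (soft_indic_bounded U n).

Lemma soft_indic_cvg (U : set X) x : open U ->
  soft_indic U n x @[n --> \oo] --> (\1_U x : R).
Proof.
move=> oU; rewrite indicE /=.
have [Ux|nUx] := pselect (U x).
  rewrite mem_set//= -[X in _ --> X](subr0 1).
  apply: cvgB; first exact: cvg_cst.
  apply: cvg_expr; rewrite ger0_norm ?subr_ge0 ?codist_le1//.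
  by rewrite ltrBlDr ltrDl codist_gt0.
rewrite memNset//= (codist_out dX nUx).
under eq_fun do rewrite subr0 expr1n subrr.
exact: cvg_cst.
Qed.

Lemma measurable_evaluation_open (U : set X) : open U ->
  measurable_fun [set: borelType y0] (fun y : borelType y0 => k y U).
Proof.
move=> oU.
apply: (emeasurable_fun_cvg
  (fun n (y : borelType y0) => (integrate (soft_indic U n) (k y))%:E)).
  move=> n; apply/measurable_EFinP.
  have ci : continuous (integrate (soft_indic U n) \o k).
    move=> y; apply: continuous_comp; first exact: ck.
    exact: continuous_integrate.
  exact: (continuous_borel ci).
move=> y _ /=.
have -> : k y U = (\int[measure_at (k y) x0]_x (\1_U x)%:E)%E.
  by rewrite integral_indic ?setIT//; exact: borel_open.
have -> : (\int[measure_at (k y) x0]_x (\1_U x)%:E =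
  \int[measure_at (k y) x0]_x limn (fun n => (soft_indic U n x)%:E))%E.
  apply: eq_integral => x _; apply/esym/cvg_lim => //.
  by apply: cvg_EFin; [exact: nearW|exact: soft_indic_cvg].
under eq_fun do rewrite /integrate x0E
  fineK ?(integrable_fin_num _ (bc_integrable _ _ _))//.
apply: cvg_monotone_convergence => //.
- by move=> n; case/integrableP : (bc_integrable x0 (soft_indic U n) (k y)).
- by move=> n x _; rewrite lee_fin; have /andP[] := soft_indic_itv U n x.
- move=> x _ m n mn; rewrite lee_fin/= lerB//.
  rewrite ler_wiXn2l ?subr_ge0 ?codist_le1//.
  by rewrite lerBlDr lerDl (codist_ge0 dX).
Qed.

(** Dynkin's lemma applies since the measures are finite: the mass of a
complement is a difference. *)
Lemma measurable_evaluation (A : set X) : borel A ->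
  measurable_fun [set: borelType y0] (fun y : borelType y0 => k y A).
Proof.
apply: (@dynkin_induction _ (borelType x0) (@open X : set (set X))
  (fun A => measurable_fun [set: borelType y0]
     (fun y : borelType y0 => k y A))) => //.
- by move=> U V oU oV; exact: openI.
- by apply: measurable_evaluation_open; exact: openT.
- by move=> U oU; exact: measurable_evaluation_open.
- move=> S mS kS.
  have -> : (fun y : borelType y0 => k y (~` S)) =
      (fun y : borelType y0 => k y setT - k y S)%E.
    apply/funext => y; rewrite -setTD.
    have := @measureD _ _ _ (measure_at (k y) x0) setT S measurableT mS.
    rewrite setTI; apply.
    by rewrite -ge0_fin_numE//; exact: fin_num_measure.
  apply: emeasurable_funB => //.
  by apply: measurable_evaluation_open; exact: openT.
- move=> F mF tF kF.
  have -> : (fun y : borelType y0 => k y (\bigcup_n F n)) =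
      (fun y : borelType y0 => \sum_(0 <= n <oo) k y (F n))%E.
    apply/funext => y; apply/esym/cvg_lim => //.
    exact: radon_sigma_additive.
  by apply: ge0_emeasurable_sum => // n y _ _; exact: radon_ge0.
Qed.

End evaluation.

Lemma zero_radon_measure (R : realType) (X : topologicalType) :
  exists mu : radon_measure R X, forall A, mu A = 0%E.
Proof.
unshelve eexists (@RadonMeasure R X (fun=> 0%E) _ _ _ _ _ _) => //=.
- by move=> F _ _; under eq_fun do rewrite big1//; exact: cvg_cst.
- move=> A _; apply/eqP; rewrite eq_le; apply/andP; split.
    apply: ereal_sup_ubound; exists set0 => //; split => //.
    exact: compact0.
  by apply: ge_ereal_sup => _ [K _ <-].
Qed.

Lemma mass_le_tv_norm (R : realType) (X : topologicalType)
  (mu : radon_measure R X) : (mu setT <= tv_norm mu)%E.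
Proof.
apply: ereal_sup_ubound; exists 1, (fun=> setT); split.
- by move=> _; apply: sub_gen_smallest; exact: openT.
- by move=> i j _ _ _; rewrite !ord1.
- by apply/seteqP; split => // x _; exists ord0.
- by rewrite big_ord1 gee0_abs// radon_ge0.
Qed.

(** * The mixing operator *)

Section mixing.
Context (R : realType) (Omega : topologicalType).
Context (M : set (radon_measure R Omega)) (x0 : Omega) (m0 : M).
Context (x0E : forall (mu : radon_measure R Omega) f,
  radon_integral mu f = (\int[measure_at mu x0]_x f x)%E).
Context (m0E : forall (nu : radon_measure R M) f,
  radon_integral nu f = (\int[measure_at nu m0]_mu f mu)%E).
Context (polO : polish R Omega).

Let kernel (mu : borelType m0) : {measure set (borelType x0) -> \bar R} :=
  measure_at (set_val (mu : M)) x0.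

Let measurable_kernel A : measurable A ->
  measurable_fun [set: borelType m0] (kernel ^~ A).
Proof.
have [d dX _] := polish_metrizes polO.
apply: (measurable_evaluation dX x0E (k := set_val)).
exact: initial_continuous.
Qed.

Lemma mixing_exists c : (forall mu, M mu -> (mu setT <= c%:E)%E) ->
  exists Mix : radon_measure R M -> radon_measure R Omega, is_mixing Mix.
Proof.
move=> Mc.
suff /choice[Mix MixE] : forall nu : radon_measure R M,
    exists P : radon_measure R Omega, forall A, borel A ->
    P A = (\int[measure_at nu m0]_mu kernel mu A)%E.
  by exists Mix => nu A bA; rewrite MixE// m0E.
move=> nu.
have [|P PE] := mixture_exists (N := measure_at nu m0) measurable_kernel.
  move=> A mA; rewrite ge0_fin_numE; last exact: integral_ge0.
  apply: (@le_lt_trans _ _ (\int[measure_at nu m0]_mu c%:E)%E).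
    apply: ge0_le_integral => //; first exact: measurable_kernel.
    move=> mu _; apply: le_trans (Mc _ (set_valP mu)).
    by apply: (le_measure (kernel mu)); rewrite ?inE.
  rewrite integral_cst// ltey_eq fin_numM//.
  exact: (fin_num_measure (measure_at nu m0)).
have [mu muE] := radon_of_borel P polO.
by exists mu => A bA; rewrite muE// PE.
Qed.

Lemma integrate_mixing (f : bounded_continuous R Omega) nu
    (P : radon_measure R Omega) :
  (forall A, borel A -> P A = radon_integral nu (fun mu : M => set_val mu A)) ->
  integrate f P =
    fine (radon_integral nu (fun mu : M => (integrate f (set_val mu))%:E)).
Proof.
move=> PE; rewrite /integrate x0E m0E; congr fine.
under [RHS]eq_integral do
  rewrite x0E fineK ?(integrable_fin_num _ (bc_integrable x0 f _))//.
apply: (@integral_mixture _ _ _ _ _ (measure_at nu m0) kernel) => //.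
- by move=> A mA; rewrite -m0E; exact: PE.
- by move=> mu; exact: bc_integrable.
- exact: bc_integrable.
Qed.

(** The bound on the total masses in [M] enters here: it makes the integrand
obtained by exchanging the integrals an admissible test function. *)
Lemma bounded_integrate c (f : bounded_continuous R Omega) :
  (forall mu, M mu -> (mu setT <= c%:E)%E) ->
  bounded_fun (fun mu : M => integrate f (set_val mu)).
Proof.
move=> Mc; have [C C0 fC] := bc_bound x0 f.
exists (C * c); split; first exact: num_real.
move=> K /ltW CcK mu _ /=; apply: le_trans CcK.
rewrite /integrate x0E; apply: le_trans (bc_integral_le x0 _ fC) _.
rewrite ler_wpM2l// -lee_fin fineK; first exact: Mc (set_valP mu).
exact: (fin_num_measure (measure_at (set_val mu) x0)).
Qed.

End mixing.

Theorem theorem3p3 (R : realType) (Omega : topologicalType)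
    (polish_Omega : polish R Omega)
    (M : set (radon_measure R Omega))
    (closed_M : closed M) (bounded_M : norm_bounded M) :
  (exists Mix : radon_measure R M -> radon_measure R Omega, is_mixing Mix) /\
  (forall Mix : radon_measure R M -> radon_measure R Omega,
     is_mixing Mix -> continuous Mix).
Proof.
have [c Mc] : exists c, forall mu, M mu -> (mu setT <= c%:E)%E.
  case: bounded_M => c Mc; exists c => mu /Mc; apply: le_trans.
  exact: mass_le_tv_norm.
have [z z0] := zero_radon_measure R Omega.
have intO f (mu : radon_measure R Omega) :
    (Omega -> False) -> integrate f mu = 0.
  move=> nO; rewrite /integrate /radon_integral; case: pselect => //.
  by move=> [x]; have := nO x.
have intM (nu : radon_measure R M) f :
    (M -> False) -> radon_integral nu f = 0%E.
  move=> M0; rewrite /radon_integral; case: pselect => //.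
  by move=> [x]; have := M0 x.
have intF (f : bounded_continuous R Omega) Mix (MixE : is_mixing Mix) nu :
    integrate f (Mix nu) =
    fine (radon_integral nu (fun mu : M => (integrate f (set_val mu))%:E)).
  have [nO | [x0 x0E]] := radon_integral_point R Omega.
    rewrite intO// /radon_integral; case: pselect => // ex.
    rewrite integral0_eq// => mu _; congr EFin; exact: intO.
  have [M0 | [m0 m0E]] := radon_integral_point R M.
    rewrite intM// /integrate x0E.
    rewrite (eq_measure_integral mzero) ?integral_measure_zero//.
    move=> A bA _; exact: etrans (MixE nu A bA) (intM _ _ M0).
  exact: (integrate_mixing x0E m0E polish_Omega f (MixE nu)).
split.
  have [nO | [x0 x0E]] := radon_integral_point R Omega.
    exists (fun=> z) => nu A _; rewrite z0 /radon_integral.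
    case: pselect => // ex; rewrite integral0_eq// => mu _.
    have -> : A = set0 by rewrite -subset0 => x _; exact: nO x.
    exact: radon0.
  have [M0 | [m0 m0E]] := radon_integral_point R M.
    by exists (fun=> z) => nu A _; rewrite z0 intM.
  exact: (mixing_exists x0E m0E polish_Omega Mc).
move=> Mix MixE; apply: continuous_narrow => f.
have cF : continuous (fun mu : M => integrate f (set_val mu)).
  move=> mu; apply: (@continuous_comp _ _ _ set_val (integrate f)).
    exact: initial_continuous.
  exact: continuous_integrate.
have bF : bounded_fun (fun mu : M => integrate f (set_val mu)).
  have [nO | [x0 x0E]] := radon_integral_point R Omega; last first.
    exact: (bounded_integrate x0E f Mc).
  by exists 0; split => // K K0 mu _ /=; rewrite intO// normr0 ltW.
have -> : integrate f \o Mix = integrate (Build_bounded_continuous cF bF).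
  by apply/funext => nu; rewrite /= intF.
exact: continuous_integrate.
Qed.
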